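(* Let $G$ be a $4$-tough graph on $n\ge 3$ vertices with degree sequence $d_1\le d_2\le\dots\le d_n$. Suppose that for every integer $i$ with $1\le i<\frac{n}{2}$: if $d_i\le i$ then $d_{n-i+4}\ge n-i$. Then $G$ is Hamiltonian.
   Context: Graphs are finite and simple and have at least three vertices. A subset $C$ of vertices of a graph $G=(V,E)$ is a cut-set if the induced subgraph $G[V\setminus C]$ is disconnected ($C=\emptyset$ is allowed when $G$ itself is disconnected). For a real number $t$, $G$ is $t$-tough if for every cut-set $C$ of $G$, $t\cdot c(G[V\setminus C])\le |C|$, where $c(H)$ denotes the number of connected components of $H$ (in particular complete graphs are $t$-tough for every $t$). The degree sequence of $G$ is the list of its vertex degrees in non-decreasing order $d_1\le\dots\le d_n$. A graph is Hamiltonian if it contains a cycle (not necessarily induced) through all of its vertices. (For a $4$-tough graph, $d_i\le i<\frac n2$ can only occur with $i\ge 8$, so the index $n-i+4$ is always at most $n$ when it is used.) *)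

(* Defs.v *)
From mathcomp Require Import all_boot all_order all_algebra.
From mathcomp Require Import reals.

Set Implicit Arguments.
Unset Strict Implicit.
Unset Printing Implicit Defensive.

(* A graph on the vertex set V is a relation e : rel V, assumed symmetric and
   irreflexive where it is used. *)

(* The induced subgraph e[S] is kept as a relation on V, with no edge meeting
   the complement of S; it is only ever examined on S. *)
Definition induced (V : finType) (e : rel V) (S : {set V}) : rel V :=
  [rel x y in S | e x y].

(* S is a union of classes of the induced relation, so this does not count the
   isolated points outside S; it is 0 when S is empty. *)
Definition num_components (V : finType) (e : rel V) (S : {set V}) : nat :=
  n_comp (induced e S) S.

Definition disconnected (V : finType) (e : rel V) (S : {set V}) : bool :=
  [exists x in S, exists y in S, ~~ connect (induced e S) x y].

Definition cut_set (V : finType) (e : rel V) (C : {set V}) : bool :=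
  disconnected e (~: C).

Definition tough (R : realType) (t : R) (V : finType) (e : rel V) : Prop :=
  forall C : {set V}, cut_set e C ->
    (t * (num_components e (~: C))%:R <= #|C|%:R)%R.

Definition degree (V : finType) (e : rel V) (x : V) : nat :=
  #|[set y | e x y]|.

Definition degree_sequence (V : finType) (e : rel V) : seq nat :=
  sort leq [seq degree e x | x <- enum V].

(* d_i with the usual numbering from 1; indices above #|V| give 0. *)
Definition nth_degree (V : finType) (e : rel V) (i : nat) : nat :=
  nth 0 (degree_sequence e) i.-1.

(* ucycle alone would accept the empty sequence and a single edge traversed
   back and forth. *)
Definition is_cycle (V : finType) (e : rel V) (p : seq V) : Prop :=
  2 < size p /\ ucycle e p.

Definition hamiltonian (V : finType) (e : rel V) : Prop :=
  exists p : seq V, is_cycle e p /\ forall x : V, x \in p.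

(* Main.v *)
(** Take a non-Hamiltonian supergraph of G with as many edges as possible.  It
    inherits the degree condition and the part of toughness that is needed, and
    any two of its non-adjacent vertices are joined by a Hamiltonian path.  Let
    x be a vertex of maximum degree among those not adjacent to everything, u a
    non-neighbour of x of maximum degree j, and U the set of universal vertices.
    On a Hamiltonian path from u to x the j predecessors of neighbours of u are
    not adjacent to x, hence have degree at most j, and j + d(x) < n.  The
    degree condition then gives j - 3 vertices of degree at least n - j > d(x),
    which are universal by the choice of x: |U| >= j - 3 > 0, as j >= 8 by
    toughness at N(u).  The set I of
    predecessors of U is independent, and each of its members has at most
    j - |U| <= 3 neighbours outside U, so |N(I)| <= 4|U| = 4|I|; but deleting
    N(I) isolates every vertex of I and leaves x, against 4-toughness. *)

Require Import Defs.
From mathcomp Require Import all_boot all_order all_algebra.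
From mathcomp Require Import boolp reals.
From mathcomp Require Import zify.

Set Implicit Arguments.
Unset Strict Implicit.
Unset Printing Implicit Defensive.

(** * Reading a sorted degree sequence through counts *)

Section SortedCounts.

Implicit Types s : seq nat.

Lemma all_drop_sort s k : all (leq (nth 0 (sort leq s) k)) (drop k (sort leq s)).
Proof.
apply/(all_nthP 0) => i; rewrite size_drop nth_drop => ik.
apply: (sorted_leq_nth leq_trans leqnn 0 (sort_sorted leq_total s)).
- rewrite inE; lia.
- rewrite inE; lia.
- exact: leq_addr.
Qed.

(** If entry [k] exceeded [m], so would every later one, and only the first [k] entries could be
    counted. *)
Lemma nth_sort_leq s k m :
  k < count (fun d => d <= m) s -> nth 0 (sort leq s) k <= m.
Proof.
rewrite leqNgt -(count_sort leq) => k_lt; apply/negP => m_lt; move: k_lt.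
rewrite -[X in count _ X](cat_take_drop k) count_cat.
have := count_size (fun d => d <= m) (take k (sort leq s)).
have -> : count (fun d => d <= m) (drop k (sort leq s)) = 0.
  apply/eqP; rewrite -leqn0 leqNgt -has_count -all_predC.
  apply: sub_all (all_drop_sort s k) => d /=; lia.
rewrite size_take; case: ifP; lia.
Qed.

(** All entries from index [k] on are counted; past the end the default 0 is harmless because
    [size s - k] vanishes. *)
Lemma count_geq_nth_sort s k m :
  m <= nth 0 (sort leq s) k -> size s - k <= count (leq m) s.
Proof.
move=> m_le; rewrite -(count_sort leq) -[X in count _ X](cat_take_drop k).
rewrite count_cat.
have /eqP -> : count (leq m) (drop k (sort leq s)) == size (drop k (sort leq s)).
  rewrite -all_count; apply: sub_all (all_drop_sort s k) => d.
  exact: leq_trans.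
by rewrite size_drop size_sort leq_addl.
Qed.

End SortedCounts.

Lemma count_degree (V : finType) (e : rel V) (P : pred nat) :
  count P [seq degree e x | x <- enum V] = #|[set x | P (degree e x)]|.
Proof. by rewrite count_map cardsE cardE -size_filter enumT. Qed.

(** * Hamiltonian paths and their rotations *)

Section Cycles.

Variables (V : finType) (e : rel V).
Hypotheses (e_sym : symmetric e) (e_irr : irreflexive e).

Lemma path_rev_cons z h s :
  path e z (rev (h :: s)) = e z (last h s) && path e h s.
Proof.
rewrite lastI rev_rcons /= rev_path; congr (_ && _).
by apply: eq_path => a b; rewrite e_sym.
Qed.

Lemma last_rev_cons (z h : V) s : last z (rev (h :: s)) = h.
Proof. by rewrite rev_cons last_rcons. Qed.

(** [prev] is the cyclic predecessor, but [b] is not the head [u], so it is the predecessor along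
    the list. *)
Lemma prev_splice (u b : V) p1 p2 : uniq (u :: p1 ++ b :: p2) ->
  prev (u :: p1 ++ b :: p2) b = last u p1.
Proof.
rewrite -cat_cons cat_uniq => /and3P[_ /hasPn/(_ b)]; rewrite mem_head => /(_ isT).
move=> b_notin _; rewrite prev_nth mem_cat mem_head orbT /=.
have b_p1 : b \notin p1 by apply: contra b_notin; rewrite inE orbC => ->.
rewrite index_cat (negPf b_p1) /= eqxx addn0 -cat_cons nth_cat /= ltnSn.
by rewrite -[size p1]/((size (u :: p1)).-1) nth_last.
Qed.

Definition ham_path u x p :=
  [/\ path e u p, last u p = x, uniq (u :: p) & forall y, y \in u :: p].

Lemma hamiltonian_perm s c : uniq s -> (forall y, y \in s) -> 2 < size s ->
  perm_eq c s -> cycle e c -> hamiltonian e.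
Proof.
move=> s_uniq s_all s_gt2 c_s c_cycle; exists c; split.
  by split; rewrite ?(perm_size c_s) // /ucycle c_cycle (perm_uniq c_s).
by move=> y; rewrite (perm_mem c_s).
Qed.

Section NonHamiltonianPath.

Variables (u x : V) (p : seq V).
Hypotheses (p_ham : ham_path u x p) (V_ge3 : 2 < #|V|).
Hypothesis not_ham : ~ hamiltonian e.

Let p_uniq : uniq (u :: p). Proof. by case: p_ham. Qed.

Lemma mem_ham_path b : e u b -> b \in p.
Proof.
case: p_ham => _ _ _ p_all ub; have := p_all b; rewrite inE => /predU1P[eq_bu|//].
by rewrite eq_bu e_irr in ub.
Qed.

Lemma size_ham_path : 2 < size (u :: p).
Proof.
case: p_ham => _ _ _ p_all; rewrite -(card_uniqP p_uniq).
by apply: leq_trans V_ge3 _; apply: subset_leq_card; apply/subsetP => y _.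
Qed.

(* The rotation u ... a | b ... x  ->  a ... u b ... x. *)
Lemma prev_nonadj b : e u b -> ~~ e (prev (u :: p) b) x.
Proof.
move=> ub; apply/negP => ax; apply: not_ham.
case: (p_ham) => p_path p_last _ p_all.
have /splitPr def_p := mem_ham_path ub.
case: def_p ax p_path p_last p_all p_uniq size_ham_path => p1 p2.
move=> ax p_path p_last p_all uniq_p p_size; move: ax; rewrite prev_splice // => ax.
apply: (@hamiltonian_perm _ (rev (u :: p1) ++ b :: p2) uniq_p p_all p_size).
  by rewrite -cat_cons perm_cat2r perm_rev.
rewrite (cycle_path x) last_cat cat_path path_rev_cons !last_rev_cons /=.
move: p_path p_last; rewrite cat_path last_cat /= => /and3P[-> _ ->] p_last.
by rewrite p_last [e x _]e_sym ax ub.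
Qed.

(* The double rotation u ... a | b ... a' | b' ... x
   ->  u ... a a' ... b x ... b'. *)
Lemma prev_stable b b' : e u b -> e u b' -> e b x -> e b' x ->
  ~~ e (prev (u :: p) b) (prev (u :: p) b').
Proof.
case: (p_ham) => p_path p_last _ p_all.
(* By symmetry of [e] it suffices to treat [c] preceding [c'] on the path. *)
have ordered q1 q2 q3 c c' : p = q1 ++ c :: q2 ++ c' :: q3 ->
    e u c' -> e c x -> ~~ e (prev (u :: p) c) (prev (u :: p) c').
  move=> def_p uc' cx; apply/negP => aa'; apply: not_ham.
  have p_size := size_ham_path.
  move: aa' p_path p_last p_all p_uniq p_size; rewrite {}def_p.
  move=> aa' p_path p_last p_all uniq_p p_size.
  move: aa'; rewrite {1}prev_splice //.
  have def_p : q1 ++ c :: q2 ++ c' :: q3 = (q1 ++ c :: q2) ++ c' :: q3.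
    by rewrite -catA.
  rewrite def_p prev_splice -?def_p // last_cat /= => aa'.
  apply: (@hamiltonian_perm _ ((u :: q1) ++ rev (c :: q2) ++ rev (c' :: q3)) uniq_p p_all p_size).
    by rewrite -cat_cons perm_cat2l -cat_cons; apply: perm_cat; rewrite perm_rev.
  rewrite (cycle_path x) !last_cat last_rev_cons /= !cat_path !path_rev_cons last_rev_cons.
  move: p_path p_last; rewrite cat_path last_cat /= cat_path last_cat /=.
  move=> /and5P[-> _ -> _ ->] ->.
  by rewrite [e c' u]e_sym uc' aa' cx.
move=> ub ub' bx b'x; case: (eqVneq b b') => [->|b'_b]; first by rewrite e_irr.
have split_mem (c : V) (q : seq V) : c \in q -> exists q1 q2, q = q1 ++ c :: q2.
  by case/splitPr => q1 q2; exists q1, q2.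
have [p1 [p2 def_p]] := split_mem _ _ (mem_ham_path ub).
have := mem_ham_path ub'; rewrite {1}def_p mem_cat inE eq_sym (negPf b'_b) /=.
case/orP => /split_mem[q1 [q2 def_q]].
  rewrite e_sym; apply: (ordered q1 q2 p2) => //.
  by rewrite def_p def_q -catA.
by apply: (ordered p1 q1 q2) => //; rewrite def_p def_q.
Qed.

Lemma prev_ham_path_inj : injective (prev (u :: p)).
Proof. exact: can_inj (next_prev p_uniq). Qed.

(** Only the head [u] has the last vertex [x] as cyclic predecessor, and [b] differs from [u] by
    irreflexivity. *)
Lemma prev_neq_last b : e u b -> prev (u :: p) b != x.
Proof.
case: (p_ham) => p_path p_last _ p_all ub; apply/eqP => def_x.
have /splitPr def_p := mem_ham_path ub.
case: def_p def_x p_last p_uniq => p1 p2 def_x p_last uniq_p.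
move: def_x; rewrite prev_splice // => def_x.
move: uniq_p; rewrite -cat_cons cat_uniq => /and3P[_ /hasPn/(_ x)].
rewrite -{2}def_x mem_last -p_last last_cat /= mem_last => /(_ isT).
by [].
Qed.

End NonHamiltonianPath.


(** * Adding one edge; complete graphs *)

Definition add_edge (u x : V) : rel V :=
  [rel a b | [|| e a b, (a == u) && (b == x) | (a == x) && (b == u)]].

Lemma add_edge_sym u x : symmetric (add_edge u x).
Proof.
by move=> a b; rewrite /add_edge /= e_sym; congr (_ || _); rewrite orbC ![(b == _) && _]andbC.
Qed.

Lemma add_edge_irr u x : u != x -> irreflexive (add_edge u x).
Proof.
move=> ux a; rewrite /add_edge /= e_irr /=; case: (eqVneq a u) => [->|_]; last by rewrite andbF.
by rewrite (negPf ux).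
Qed.

Lemma add_edge_away u x a b : a != u -> b != u -> add_edge u x a b = e a b.
Proof. by rewrite /add_edge /= => /negPf-> /negPf->; rewrite andbF !orbF. Qed.

(** The Hamiltonian cycle must use the new edge; once rotated to start at [u], it has [x] second or
    last, and deleting that edge leaves the path. *)
Lemma ham_path_add_edge u x : u != x -> hamiltonian (add_edge u x) ->
  ~ hamiltonian e -> exists p, ham_path u x p.
Proof.
move=> ux [c [[c_size /andP[c_cycle c_uniq]] c_all]] not_ham.
case/rot_to: (c_all u) => i s def_s.
have {c_cycle} : cycle (add_edge u x) (u :: s) by rewrite -def_s rot_cycle.
have {c_uniq} s_uniq : uniq (u :: s) by rewrite -def_s rot_uniq.
have {c_all} s_all y : y \in u :: s by rewrite -def_s mem_rot.
have {c_size def_s c i} s_size : 2 < size (u :: s) by rewrite -def_s size_rot.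
have /andP[u_s s_uniq'] := s_uniq.
(* Only the two cycle edges at [u] can be new. *)
have away : {in predC1 u &, add_edge u x =2 e}.
  by move=> a b; rewrite !inE => au bu; rewrite add_edge_away.
case: s => [|y s] // in s_uniq s_all s_size u_s s_uniq' *.
have inner : path (add_edge u x) y s = path e y s.
  apply: (eq_in_path away); apply/allP => z z_s; rewrite inE.
  by apply: contraNneq u_s => <-.
rewrite /= rcons_path inner => /and3P[uy y_s yu].
have lastNu : last y s != u by apply: contraNneq u_s => <-; rewrite mem_last.
move: uy yu; rewrite /add_edge /= eqxx (negPf ux) andbT /= orbF (negPf lastNu) /=.
have [def_y _|yNx] := eqVneq y x; last rewrite orbF => uy.
  (* With at least three vertices the two cycle neighbours of [u] differ, so the closing edge is old
     and the path runs backwards from [u] to [x]. *)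
  have lastNx : last y s != x.
    rewrite -def_y; case: s {inner y_s lastNu s_all u_s s_uniq} s_size s_uniq' => //= z s _.
    by move=> /andP[y_s _]; apply: contraNneq y_s => <-; rewrite mem_last.
  rewrite (negPf lastNx) /= orbF => yu.
  exists (rev (y :: s)); split.
  - by rewrite path_rev_cons e_sym yu y_s.
  - by rewrite last_rev_cons.
  - by rewrite /= mem_rev rev_uniq.
  - by move=> z; rewrite inE mem_rev -in_cons.
have [def_x _|lastNx] := eqVneq (last y s) x.
  by exists (y :: s); split => //=; rewrite uy.
rewrite orbF => yu; case: not_ham; exists (u :: y :: s); split => //.
by split => //; rewrite /ucycle s_uniq andbT /= rcons_path uy y_s.
Qed.

Lemma complete_hamiltonian : 2 < #|V| -> (forall a b, a != b -> e a b) -> hamiltonian e.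
Proof.
move=> V_ge3 e_full; exists (enum V); split; last by move=> x; rewrite mem_enum.
split; first by rewrite -cardE.
rewrite /ucycle enum_uniq andbT.
rewrite cardE in V_ge3.
move: (enum V) (enum_uniq V) V_ge3 => -[|a s] //= s_uniq s_size.
have /andP[a_s _] := s_uniq.
rewrite rcons_path; apply/andP; split.
  apply: (@pairwise_sorted _ e (a :: s)).
  have : pairwise [rel y z | y != z] (a :: s) by rewrite -uniq_pairwise.
  by apply: sub_pairwise => y z; apply: e_full.
apply: e_full; apply: contraNneq a_s => last_a; rewrite -{1}last_a.
by case: s s_size {s_uniq last_a} => //= b s _; rewrite mem_last.
Qed.



Definition universal := [set y | [forall z, (z != y) ==> e y z]].

Lemma universalP y z : y \in universal -> z != y -> e y z.
Proof. by rewrite inE => /forallP/(_ z)/implyP. Qed.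

End Cycles.

(** * Toughness and degrees in a form stable under adding edges *)

Definition neighborhood (V : finType) (e : rel V) (I : {set V}) :=
  \bigcup_(a in I) [set y | e a y].

(* Toughness only for the cut-sets N(I), where I is independent and some vertex
   x lies outside I and N(I): in this form it is inherited by supergraphs. *)
Definition independent_tough (t : nat) (V : finType) (e : rel V) :=
  forall (I : {set V}) (x : V), I != set0 -> x \notin I ->
    {in I, forall a, ~~ e a x} -> {in I &, forall a b, ~~ e a b} ->
    t * #|I|.+1 <= #|neighborhood e I|.

(** Order statistics become counts: $d_j\le j$ says that at least $j$ degrees are at most $j$, and
    $d_{n-j+t}\ge n-j$ that at least $j-t+1$ are at least $n-j$. The last inequality is arranged to
    avoid truncated subtraction. *)
Definition degree_condition (t : nat) (V : finType) (e : rel V) :=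
  forall j, 0 < j -> 2 * j < #|V| -> j <= #|[set y | degree e y <= j]| ->
    j < t + #|[set y | #|V| - j <= degree e y]|.

(** Deleting the neighbourhood of [I] isolates each vertex of [I], and [x] survives in yet another
    component. *)
Lemma independent_tough_of_tough (R : realType) (t : nat) (V : finType) (e : rel V) :
  symmetric e -> tough (t%:R : R)%R e -> independent_tough t e.
Proof.
move=> e_sym e_tough I x I_neq0 x_I I_x I_indep.
set C := neighborhood e I.
have C_I a : a \in I -> a \in ~: C.
  move=> a_I; rewrite inE; apply/bigcupP => -[b b_I]; rewrite inE => ba.
  by have := I_indep b a b_I a_I; rewrite ba.
have x_C : x \in ~: C.
  rewrite inE; apply/bigcupP => -[b b_I]; rewrite inE => bx.
  by have := I_x b b_I; rewrite bx.
have ind_sym : connect_sym (induced e (~: C)).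
  apply: sym_connect_sym => a b; rewrite /induced /= e_sym.
  by rewrite [(a \in _) && _]andbC.
have isolated a y : a \in I -> connect (induced e (~: C)) a y -> y = a.
  move=> a_I /connectP[[|b s] //= /andP[/andP[/andP[_ b_C] ab] _] _].
  move: b_C; rewrite inE; case/negP; apply/bigcupP.
  by exists a => //; rewrite inE.
have cutC : cut_set e C.
  case/set0Pn: I_neq0 => a a_I; apply/existsP; exists a; rewrite C_I //=.
  apply/existsP; exists x; rewrite x_C; apply/negP => /(isolated _ _ a_I) def_x.
  by rewrite def_x a_I in x_I.
have := e_tough C cutC; rewrite -GRing.natrM Num.Theory.ler_nat; apply: leq_trans.
rewrite leq_mul2l; apply/orP; right.
(* Components are counted by their canonical roots: each vertex of [I] is its own root, and that of
   [x] is one more. *)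
pose r := fingraph.root (induced e (~: C)) x.
have r_I : r \notin I.
  apply: contra x_I => r_I; rewrite (isolated _ x r_I) // ind_sym connect_root //.
have -> : #|I|.+1 = #|r |: I| by rewrite cardsU1 r_I.
have root_C y : y \in ~: C -> fingraph.root (induced e (~: C)) y \in ~: C.
  case/connectP: (connect_root (induced e (~: C)) y) => s s_path ->.
  case/lastP: s s_path => // s z; rewrite rcons_path last_rcons.
  by move=> /andP[_ /= /andP[/andP[_ z_C] _]] _.
apply: subset_leq_card; apply/subsetP => y; rewrite in_setU1 => /predU1P[->|y_I]; apply/andP.
  by split; [exact: roots_root | exact: root_C].
split; last exact: C_I.
by apply/eqP; exact: isolated y_I (connect_root _ _).
Qed.

Lemma neighborhood_set1 (V : finType) (e : rel V) u :
  #|neighborhood e [set u]| = degree e u.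
Proof. by rewrite /neighborhood big_set1. Qed.

Lemma card_neighborhood_leq (V : finType) (e : rel V) (U I : {set V}) m :
  {in I, forall a, #|[set y | e a y] :\: U| <= m} ->
  #|neighborhood e I| <= #|U| + #|I| * m.
Proof.
move=> I_m; have sub : neighborhood e I \subset U :|: \bigcup_(a in I) ([set y | e a y] :\: U).
  apply/subsetP => y /bigcupP[a a_I ay]; rewrite in_setU; case: (boolP (y \in U)) => //= y_U.
  by apply/bigcupP; exists a; rewrite // in_setD y_U.
apply: leq_trans (subset_leq_card sub) _; apply: leq_trans (leq_card_setU _ _) _.
rewrite leq_add2l -sum_nat_const.
elim/big_rec2: _ => [|a m' S a_I S_m]; first by rewrite cards0.
by apply: leq_trans (leq_card_setU _ _) _; apply: leq_add => //; apply: I_m.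
Qed.

(** * The edge-maximal case *)

Section EdgeMaximal.

Variables (t : nat) (V : finType) (e : rel V).
Hypotheses (t_gt0 : 0 < t) (V_ge3 : 2 < #|V|).
Hypotheses (e_sym : symmetric e) (e_irr : irreflexive e).
Hypotheses (e_tough : independent_tough t e) (e_deg : degree_condition t e).
Hypothesis e_paths : forall u x, u != x -> ~~ e u x -> exists p, ham_path e u x p.

(** Edge-maximality enters as [e_paths], the Hamiltonian paths between non-adjacent vertices. *)
Lemma edge_maximal_hamiltonian : ~ ~ hamiltonian e.
Proof.
move=> not_ham.
have [x0 x0_U] : exists x0, x0 \notin universal e.
  apply/existsP; apply: contraPT not_ham => /existsPn all_U; apply.
  apply: complete_hamiltonian => // a b ab.
  by apply: universalP; [have := all_U a; rewrite negbK | rewrite eq_sym].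
case: (@arg_maxnP _ x0 (fun y => y \notin universal e) (degree e) x0_U) => x x_U x_max {x0 x0_U}.
have [u0 u0_x] : exists u0, (u0 != x) && ~~ e x u0.
  by move: x_U; rewrite inE => /forallPn[z]; rewrite negb_imply; exists z.
case: (@arg_maxnP _ u0 (fun z => (z != x) && ~~ e x z) (degree e) u0_x).
move=> u /andP[u_x xu] u_max {u0 u0_x}.
have [p p_ham] : exists p, ham_path e u x p by apply: e_paths; rewrite // e_sym.
set j := degree e u.
have p_inj : injective (prev (u :: p)) := prev_ham_path_inj p_ham.
pose A := prev (u :: p) @: [set y | e u y].
have A_card : #|A| = j by rewrite card_imset.
have A_x a : a \in A -> (a != x) && ~~ e x a.
  case/imsetP => b; rewrite inE => ub ->.
  by rewrite (prev_neq_last e_irr p_ham) // e_sym (prev_nonadj e_sym e_irr p_ham).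
have A_j a : a \in A -> degree e a <= j by move/A_x/u_max.
have u_U : u \notin universal e.
  by apply: contra xu => /universalP; rewrite e_sym; apply; rewrite eq_sym.
have j_x : j <= degree e x := x_max _ u_U.
have jx_V : j + degree e x < #|V|.
  (* [A] and the neighbourhood of [x] are disjoint and both avoid [x]. *)
  have : [disjoint A & [set y | e x y]].
    apply/pred0P => y /=; rewrite inE; apply/negP => /andP[/A_x/andP[_ /negPf->]].
    by [].
  rewrite -leq_card_setU /degree -A_card => /eqP <-.
  apply: (@leq_ltn_trans #|~: [set x]|); last by rewrite cardsC1; lia.
  apply: subset_leq_card; apply/subsetP => y; rewrite !inE => /orP[/A_x/andP[] //|].
  by apply: contraTneq => ->; rewrite e_irr.
have deg_u : t * 2 <= j.
  have := @e_tough [set u] x; rewrite cards1 neighborhood_set1; apply.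
  - by apply/set0Pn; exists u; rewrite set11.
  - by rewrite inE eq_sym.
  - by move=> a /set1P ->; rewrite e_sym.
  - by move=> a b /set1P -> /set1P ->; rewrite e_irr.
have U_nbr a : a \notin universal e -> universal e \subset [set y | e a y].
  move=> a_U; apply/subsetP => y y_U; rewrite inE e_sym.
  by apply: (universalP y_U); apply: contraNneq a_U => ->.
have U_j : #|universal e| <= j by apply: subset_leq_card; exact: U_nbr.
have U_card : j < t + #|universal e|.
  have j_gt0 : 0 < j by lia.
  have j_low : j <= #|[set y | degree e y <= j]|.
    by rewrite -A_card; apply: subset_leq_card; apply/subsetP => a /A_j; rewrite inE A_card.
  have : 2 * j < #|V| by lia.
  move=> /(e_deg j_gt0)/(_ j_low) /leq_trans; apply; rewrite leq_add2l.
  apply: subset_leq_card; apply/subsetP => y; rewrite inE; apply: contraTT => /x_max y_x.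
  rewrite -ltnNge; move: y_x jx_V; rewrite /geq /=; lia.
pose I := prev (u :: p) @: universal e.
have I_card : #|I| = #|universal e| by rewrite card_imset.
have I_A : {subset I <= A}.
  by apply/subsetP; apply: imsetS; exact: U_nbr.
have I_U a : a \in I -> a \notin universal e.
  move=> /I_A/A_x/andP[ax xa]; apply: contra xa => /universalP; rewrite e_sym; apply.
  by rewrite eq_sym.
have U_x y : y \in universal e -> e y x.
  by move=> /(subsetP (U_nbr x x_U)); rewrite inE e_sym.
have U_u y : y \in universal e -> e u y.
  by move=> /(subsetP (U_nbr u u_U)); rewrite inE.
have : t * #|I|.+1 <= #|neighborhood e I|.
  apply: (e_tough (x := x)).
  (* [deg_u] and [U_card] give [t < #|universal e|]. *)
  - rewrite -card_gt0 I_card; lia.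
  - by apply/negP => /I_A/A_x; rewrite eqxx.
  - by move=> a /I_A/A_x/andP[_]; rewrite e_sym.
  - move=> _ _ /imsetP[b b_U ->] /imsetP[b' b'_U ->].
    by apply: (prev_stable e_sym e_irr p_ham) => //; [exact: U_u|exact: U_u|exact: U_x|exact: U_x].
have : #|neighborhood e I| <= #|universal e| + #|I| * (j - #|universal e|).
  apply: card_neighborhood_leq => a a_I.
  (* Being non-universal, [a] is adjacent to all of [universal e], which takes up that many of its
     at most [j] neighbours. *)
  rewrite cardsD (setIidPr (U_nbr a (I_U a a_I))); apply: leq_sub2r.
  exact: A_j (I_A a a_I).
(* By [U_card], [j - #|universal e| <= t - 1], so the neighbourhood has at most [t * #|universal e|]
   elements, fewer than toughness demands. *)
rewrite I_card; nia.
Qed.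

End EdgeMaximal.

(** * Reduction to the edge-maximal case *)

Section SupergraphMonotonicity.

Variables (t : nat) (V : finType) (e e' : rel V).
Hypothesis e_e' : subrel e e'.

Lemma degree_subrel y : degree e y <= degree e' y.
Proof. by apply: subset_leq_card; apply/subsetP => z; rewrite !inE; apply: e_e'. Qed.

(** A set independent in [e'] is independent in [e], and its neighbourhood only grows. *)
Lemma independent_tough_subrel : independent_tough t e -> independent_tough t e'.
Proof.
move=> e_tough I x I_neq0 x_I I_x I_indep; apply: leq_trans (e_tough I x _ _ _ _) _ => //.
- by move=> a /I_x; apply: contra; apply: e_e'.
- by move=> a b a_I b_I; apply: contra (I_indep a b a_I b_I); apply: e_e'.
apply: subset_leq_card; apply/subsetP => y /bigcupP[a a_I]; rewrite inE => ay.
by apply/bigcupP; exists a => //; rewrite inE e_e'.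
Qed.

(** Added edges can only shrink the set of low degrees and enlarge that of high ones. *)
Lemma degree_condition_subrel : degree_condition t e -> degree_condition t e'.
Proof.
move=> e_deg j j_gt0 j_V j_low; apply: leq_trans (e_deg j j_gt0 j_V _) _.
  apply: leq_trans j_low _; apply: subset_leq_card; apply/subsetP => y; rewrite !inE.
  exact: leq_trans (degree_subrel y).
rewrite leq_add2l; apply: subset_leq_card; apply/subsetP => y; rewrite !inE => y_high.
exact: leq_trans y_high (degree_subrel y).
Qed.

End SupergraphMonotonicity.

(** Induction on the number of non-adjacent ordered pairs: adding a missing edge gives a Hamiltonian
    graph by induction, so [ham_path_add_edge] supplies the paths of the edge-maximal case. *)
Lemma independent_tough_hamiltonian (t : nat) (V : finType) (e : rel V) :
  0 < t -> 2 < #|V| -> symmetric e -> irreflexive e ->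
  independent_tough t e -> degree_condition t e -> hamiltonian e.
Proof.
move=> t_gt0 V_ge3.
have [m] := ubnP #|[set q : V * V | ~~ e q.1 q.2]|.
elim: m e => // m IH e e_m e_sym e_irr e_tough e_deg; apply: contrapT => not_ham.
apply: (edge_maximal_hamiltonian t_gt0 V_ge3 e_sym e_irr e_tough e_deg) => // u x ux eux.
apply: (ham_path_add_edge e_sym) => //.
have e_add : subrel e (add_edge e u x) by move=> a b; rewrite /add_edge /= => ->.
apply: IH.
- apply: leq_trans (e_m : _ <= m); apply: proper_card; apply/properP; split.
    by apply/subsetP => q; rewrite !inE; apply: contra; apply: e_add.
  by exists (u, x); rewrite inE //= negbK /add_edge /= !eqxx orbT.
- exact: add_edge_sym.
- exact: add_edge_irr.
- exact: independent_tough_subrel e_add e_tough.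
- exact: degree_condition_subrel e_add e_deg.
Qed.

Theorem theorem1p6 (R : realType) (V : finType) (e : rel V) (n : nat)
  (e_sym : symmetric e) (e_irr : irreflexive e)
  (card_V : #|V| = n) (n_ge3 : 3 <= n)
  (e_tough : tough (4%:R : R)%R e)
  (e_deg : forall i : nat, 1 <= i -> 2 * i < n ->
     nth_degree e i <= i -> n - i <= nth_degree e (n - i + 4)) :
  hamiltonian e.
Proof.
subst n; apply: (@independent_tough_hamiltonian 4) => //.
  exact: independent_tough_of_tough e_tough.
move=> j j_gt0 j_V; rewrite -(count_degree e (fun d => d <= j)) => j_low.
have low : nth_degree e j <= j by apply: nth_sort_leq; rewrite prednK.
(* Position [#|V| - j + 4] counted from 1 is index [#|V| - j + 3], so at least [j - 3] degrees reach
   [#|V| - j]. *)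
have := count_geq_nth_sort (e_deg j j_gt0 j_V low).
have sizeV : size (enum V) = #|V| by rewrite -cardE.
rewrite size_map sizeV count_degree; lia.
Qed.
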